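(* Let $G\subsetneq\mathbb{R}^n$ be a domain. For all $x,y\in G$, $$s_G(x,y)\le \tilde c_G(x,y)\le 2\,s_G(x,y).$$ Moreover, these constants are best possible regardless of the choice of $G$ and of $x\in G$: for every domain $G\subsetneq\mathbb{R}^n$ and every fixed $x\in G$, the largest constant $a$ such that $a\,s_G(x,y)\le\tilde c_G(x,y)$ for all $y\in G$ is $a=1$, and the smallest constant $b$ such that $\tilde c_G(x,y)\le b\,s_G(x,y)$ for all $y\in G$ is $b=2$.
   Context: A domain is a nonempty open connected set, $\partial G$ is its Euclidean boundary, and $|\cdot|$ is the Euclidean norm. For a domain $G\subsetneq\mathbb{R}^n$ and $x,y\in G$ define $$\tilde c_G(x,y)=\frac{|x-y|}{\inf_{z\in\partial G}\max\{|x-z|,|y-z|\}},\qquad s_G(x,y)=\frac{|x-y|}{\inf_{z\in\partial G}(|x-z|+|z-y|)}.$$ The function $s_G$ is called the triangular ratio metric. *)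

(* Defs.v *)
From mathcomp Require Import all_boot all_order all_algebra.
From mathcomp Require Import all_classical all_reals all_analysis.

Set Implicit Arguments.
Unset Strict Implicit.
Unset Printing Implicit Defensive.

Import Order.TTheory GRing.Theory Num.Theory.
Import numFieldNormedType.Exports.

Local Open Scope classical_set_scope.
Local Open Scope ring_scope.

(* The canonical norm `|x| on 'rV[R]_n is the sup norm, so the Euclidean norm
   is defined separately. The canonical (product) topology on 'rV[R]_n is the
   Euclidean one, so open, connected, closure and interior have their usual
   meaning. *)
Definition enorm (R : realType) (n : nat) (x : 'rV[R]_n) : R :=
  Num.sqrt (\sum_(i < n) x 0 i ^+ 2).

Definition domain (R : realType) (n : nat) (G : set 'rV[R]_n) : Prop :=
  [/\ G !=set0, open G & connected G].

Definition boundary (T : topologicalType) (A : set T) : set T :=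
  closure A `\` interior A.

(* When G is a proper domain its boundary is nonempty, so both infima below are
   over nonempty sets bounded below by 0, and both are positive for x, y in G. *)
Definition c_tilde (R : realType) (n : nat) (G : set 'rV[R]_n)
    (x y : 'rV[R]_n) : R :=
  enorm (x - y) /
  inf [set Num.max (enorm (x - z)) (enorm (y - z)) | z in boundary G].

Definition triangular_ratio (R : realType) (n : nat) (G : set 'rV[R]_n)
    (x y : 'rV[R]_n) : R :=
  enorm (x - y) /
  inf [set enorm (x - z) + enorm (z - y) | z in boundary G].

Definition is_greatest (R : realType) (A : set R) (m : R) : Prop :=
  A m /\ ubound A m.

Definition is_least (R : realType) (A : set R) (m : R) : Prop :=
  A m /\ lbound A m.

(* Main.v *)
Require Import Defs.
From mathcomp Require Import all_boot all_order all_algebra.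
From mathcomp Require Import all_classical all_reals all_analysis.
From mathcomp Require Import ring lra.

Import Order.TTheory GRing.Theory Num.Theory.
Import numFieldNormedType.Exports.

Local Open Scope classical_set_scope.
Local Open Scope ring_scope.

(** Write [S] and [M] for the infima in the denominators of [s_G(x,y)] and
    [c~_G(x,y)]; then [M <= S <= 2 M], as [max <= sum <= 2 max]. Let [d] be the distance from [x]
    to the boundary, pick a boundary point [z] with [|x - z| <= (1 + e) d], and
    move [y] along the segment from [x] to [z], staying in the ball [B(x, d)],
    which lies in [G]. At distance nearly [d] one has
    [S <= |x - z| + |z - y| <= (1 + 2 e) d] and [d <= M], so [S / M] is close to 1;
    at distance at most [e d] one has [S >= 2 d - |x - y| >= (2 - e) d] and
    [M <= (1 + e) d], so [S / M] is close to 2. *)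

(** * The Euclidean norm and its comparison with the sup norm *)

Section EuclideanNorm.
Variables (R : realType) (n : nat).
Implicit Types x y z : 'rV[R]_n.

Lemma sum_sqr_ge0 x : 0 <= \sum_(i < n) x 0 i ^+ 2.
Proof. by apply: sumr_ge0 => i _; exact: sqr_ge0. Qed.

Lemma enorm_ge0 x : 0 <= enorm x.
Proof. exact: sqrtr_ge0. Qed.

Lemma sqr_enorm x : enorm x ^+ 2 = \sum_(i < n) x 0 i ^+ 2.
Proof. by rewrite sqr_sqrtr // sum_sqr_ge0. Qed.

Lemma enormZ (a : R) x : enorm (a *: x) = `|a| * enorm x.
Proof.
rewrite /enorm -sqrtr_sqr -sqrtrM ?sqr_ge0 // mulr_sumr.
by congr Num.sqrt; apply: eq_bigr => i _; rewrite mxE exprMn.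
Qed.

Lemma enormN x : enorm (- x) = enorm x.
Proof. by rewrite -scaleN1r enormZ normrN1 mul1r. Qed.

Lemma enormB x y : enorm (x - y) = enorm (y - x).
Proof. by rewrite -enormN opprB. Qed.

Lemma coord_le_enorm x i : `|x 0 i| <= enorm x.
Proof.
rewrite -sqrtr_sqr ler_sqrt ?sum_sqr_ge0 // (bigD1 i) //= lerDl.
by apply: sumr_ge0 => j _; exact: sqr_ge0.
Qed.

Lemma enorm0_eq0 x : enorm x = 0 -> x = 0.
Proof.
move=> x0; apply/rowP => i; rewrite mxE; apply/eqP.
by rewrite -normr_le0 -x0 coord_le_enorm.
Qed.

(** With [p = enorm x * enorm y], the sum of the squares [(enorm y * x 0 i - enorm x * y 0 i) ^+ 2]
    expands to [2 p] times the difference of the two sides. Dividing by [p] requires both norms to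
    be nonzero, so zero vectors are treated first. *)
Lemma cauchy_schwarz x y :
  \sum_(i < n) x 0 i * y 0 i <= enorm x * enorm y.
Proof.
have [x0|x0] := eqVneq (enorm x) 0.
  rewrite x0 mul0r big1 // => i _.
  by rewrite (enorm0_eq0 x x0) mxE mul0r.
have [y0|y0] := eqVneq (enorm y) 0.
  rewrite y0 mulr0 big1 // => i _.
  by rewrite (enorm0_eq0 y y0) mxE mulr0.
have p0 : 0 < enorm x * enorm y by rewrite mulr_gt0 // lt0r enorm_ge0 ?x0 ?y0.
have : 0 <= \sum_(i < n) (enorm y * x 0 i - enorm x * y 0 i) ^+ 2.
  by apply: sumr_ge0 => i _; exact: sqr_ge0.
have -> : \sum_(i < n) (enorm y * x 0 i - enorm x * y 0 i) ^+ 2 =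
    2 * (enorm x * enorm y)
      * (enorm x * enorm y - \sum_(i < n) x 0 i * y 0 i).
  transitivity (enorm y ^+ 2 * (\sum_(i < n) x 0 i ^+ 2)
    - 2 * (enorm x * enorm y) * (\sum_(i < n) x 0 i * y 0 i)
    + enorm x ^+ 2 * (\sum_(i < n) y 0 i ^+ 2)).
    rewrite !mulr_sumr -sumrB -big_split /=; apply: eq_bigr => i _; ring.
  rewrite -!sqr_enorm; ring.
by rewrite pmulr_rge0 ?subr_ge0 // mulr_gt0.
Qed.

Lemma ler_enormD x y : enorm (x + y) <= enorm x + enorm y.
Proof.
rewrite -(ler_pXn2r (ltn0Sn 1)) ?nnegrE ?addr_ge0 ?enorm_ge0 //.
have -> : enorm (x + y) ^+ 2 =
    enorm x ^+ 2 + enorm y ^+ 2 + 2 * (\sum_(i < n) x 0 i * y 0 i).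
  rewrite !sqr_enorm mulr_sumr -!big_split /=.
  by apply: eq_bigr => i _; rewrite mxE; ring.
have := cauchy_schwarz x y; rewrite sqrrD -mulr_natl; lra.
Qed.

Lemma ler_enorm_sub z x y : enorm (x - y) <= enorm (x - z) + enorm (z - y).
Proof. by rewrite -[x - y](subrKA z) ler_enormD. Qed.

(** Neighbourhoods are given by sup-norm balls; this places Euclidean balls inside them. *)
Lemma norm_le_enorm x : `|x| <= enorm x.
Proof.
rewrite [`|x|]mx_normrE; apply/bigmax_leP; split; first exact: enorm_ge0.
by move=> [i j] _ /=; rewrite ord1 coord_le_enorm.
Qed.

End EuclideanNorm.

(** * Boundary points of an open set *)

Section Boundary.
Variables (R : realType) (n : nat) (G : set 'rV[R]_n).
Hypothesis openG : open G.
Implicit Types x y z : 'rV[R]_n.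

Lemma open_boundary_notin z : boundary G z -> ~ G z.
Proof. by case=> _ nGz Gz; apply: nGz; exact: open_nbhs_nbhs. Qed.

(** The boundary point is the first exit point: [t] is the infimum of the parameters at which the
    segment lies outside [G]. *)
Lemma segment_meets_boundary x y : G x -> ~ G y ->
  exists2 t, 0 <= t <= 1 & boundary G (x + t *: (y - x)).
Proof.
move=> Gx Gy; pose p (t : R) := x + t *: (y - x).
have cp : continuous p.
  move=> t; apply: cvgD; first exact: cvg_cst.
  by apply: cvgZl; exact: cvg_id.
pose E := [set t : R | 0 <= t /\ ~ G (p t)].
have E1 : E 1 by split=> //; rewrite /p scale1r addrC subrK.
have lE : lbound E 0 by move=> t [].
have infE : has_inf E by split; [exists 1 | exists 0].
have t0 : 0 <= inf E by apply: lb_le_inf => //; exists 1.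
have t1 : inf E <= 1 by apply: ge_inf => //; exists 0.
have below t : 0 <= t -> t < inf E -> G (p t).
  move=> t_ge0 tE; apply: contrapT => nG.
  have : inf E <= t by apply: ge_inf; [exists 0 | split].
  by rewrite leNgt tE.
(* The infimum is attained: if [p (inf E)] were in the open set [G], so would be [p t] for all [t]
   near [inf E], yet [E] has elements arbitrarily close to its infimum. *)
have nG : ~ G (p (inf E)).
  move=> Gp.
  have /nbhs_ballP[e /= e0 be] : nbhs (inf E) (p @^-1` G).
    by apply: (cp (inf E) G); exact: open_nbhs_nbhs.
  have [t [t_ge0 nGt] te] := inf_adherent e0 infE.
  have tE : inf E <= t by apply: ge_inf; [exists 0 | split].
  apply: nGt; apply: be.
  by rewrite /ball /= distrC ger0_norm ?subr_ge0 // ltrBlDl.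
exists (inf E); first by rewrite t0.
split; last by move=> /interior_subset.
have tpos : 0 < inf E.
  rewrite lt0r t0 andbT; apply/eqP => E0.
  by apply: nG; rewrite /p E0 scale0r addr0.
move=> B /cp /nbhs_ballP[e /= e0 be].
(* A parameter just before the exit gives a point of [G] in [B]; the maximum with 0 keeps it on the
   segment. *)
pose t := Num.max 0 (inf E - e / 2).
have tlt : t < inf E by rewrite /t gt_max tpos /=; lra.
have tge0 : 0 <= t by rewrite /t le_max lexx.
have tge : inf E - e / 2 <= t by rewrite /t le_max lexx orbT.
exists (p t); split; first exact: below.
apply: be; rewrite /ball /= ger0_norm; last by lra.
lra.
Qed.

Lemma boundary_neq0 x : G x -> G `<` [set: 'rV[R]_n] -> boundary G !=set0.
Proof.
move=> Gx [_ nT].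
have [y nGy] : exists y, ~ G y.
  by apply/existsNP => GT; apply: nT => y _; exact: GT.
by have [t _ bt] := segment_meets_boundary x y Gx nGy; eexists; exact: bt.
Qed.

(** Otherwise the segment from [x] to [y] would contain a boundary point, at distance at most
    [enorm (x - y) < d] from [x]. *)
Lemma ball_sub_domain (d : R) x y : G x ->
  (forall z, boundary G z -> d <= enorm (x - z)) ->
  enorm (x - y) < d -> G y.
Proof.
move=> Gx dz xyd; apply: contrapT => nGy.
have [t /andP[t0 t1] /dz] := segment_meets_boundary x y Gx nGy.
rewrite opprD addNKr -scalerN opprB enormZ ger0_norm //.
have := enorm_ge0 _ _ (x - y); nra.
Qed.

Lemma boundary_dist_gt0 x : G x ->
  exists2 e : R, 0 < e & forall z, boundary G z -> e <= enorm (x - z).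
Proof.
move=> Gx.
have /nbhs_ballP[e /= e0 be] : nbhs x G by exact: open_nbhs_nbhs.
exists e => // z bz; rewrite leNgt; apply/negP => ze.
apply: (open_boundary_notin z bz); apply: be.
rewrite -ball_normE /ball_ /=; exact: le_lt_trans (norm_le_enorm _ _ _) ze.
Qed.

End Boundary.

Lemma inf_image_ge {R : realType} {T : Type} (A : set T) (f : T -> R) (m : R) :
  A !=set0 -> (forall z, A z -> m <= f z) -> m <= inf [set f z | z in A].
Proof.
by move=> [z0 A0] mf; apply: lb_le_inf; [exists (f z0), z0 | move=> _ [z Az <-]; exact: mf].
Qed.

Lemma inf_image_le {R : realType} {T : Type} {A : set T} {f : T -> R} (z : T) :
  (forall z, A z -> 0 <= f z) -> A z -> inf [set f z | z in A] <= f z.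
Proof.
by move=> f0 Az; apply: ge_inf; [exists 0 => _ [w Aw <-]; exact: f0 | exists z].
Qed.

(** * Comparison of the two infima, then sharpness of the constants *)

Section Comparison.
Variables (R : realType) (n : nat) (G : set 'rV[R]_n).
Hypotheses (openG : open G) (properG : G `<` [set: 'rV[R]_n]).
Implicit Types x y z : 'rV[R]_n.

Let S x y := inf [set enorm (x - z) + enorm (z - y) | z in boundary G].
Let M x y := inf [set Num.max (enorm (x - z)) (enorm (y - z)) | z in boundary G].
Let d x := inf [set enorm (x - z) | z in boundary G].

Let S_le x y z : boundary G z -> S x y <= enorm (x - z) + enorm (z - y).
Proof. by apply: inf_image_le => w _; rewrite addr_ge0 ?enorm_ge0. Qed.

Let M_le x y z :
  boundary G z -> M x y <= Num.max (enorm (x - z)) (enorm (y - z)).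
Proof. by apply: inf_image_le => w _; rewrite le_max enorm_ge0. Qed.

Let d_le x z : boundary G z -> d x <= enorm (x - z).
Proof. by apply: inf_image_le => w _; rewrite enorm_ge0. Qed.

Let d_gt0 x : G x -> 0 < d x.
Proof.
move=> Gx; have [e e0 ez] := boundary_dist_gt0 _ _ _ openG x Gx.
apply: lt_le_trans e0 _; apply: inf_image_ge => //; exact: boundary_neq0 Gx _.
Qed.

Let M_ge_d x y : G x -> d x <= M x y.
Proof.
move=> Gx; apply: inf_image_ge; first exact: boundary_neq0 Gx _.
by move=> z bz; rewrite le_max d_le.
Qed.

Let M_le_S x y : G x -> M x y <= S x y.
Proof.
move=> Gx; apply: inf_image_ge; first exact: boundary_neq0 Gx _.
move=> z bz; apply: le_trans (M_le x y z bz) _.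
by rewrite ge_max (enormB _ _ y) lerDl lerDr !enorm_ge0.
Qed.

Let S_le_2M x y : G x -> S x y <= 2 * M x y.
Proof.
move=> Gx; rewrite mulrC -ler_pdivrMr //.
apply: inf_image_ge; first exact: boundary_neq0 Gx _.
move=> z bz; rewrite ler_pdivrMr // mulr_natr mulr2n.
apply: le_trans (S_le x y z bz) _.
by rewrite (enormB _ _ z) lerD // le_max lexx ?orbT.
Qed.

Lemma triangular_ratio_c_tilde_bounds x y : G x ->
  triangular_ratio G x y <= c_tilde G x y /\
  c_tilde G x y <= 2 * triangular_ratio G x y.
Proof.
move=> Gx; have M0 := lt_le_trans (d_gt0 x Gx) (M_ge_d x y Gx).
have S0 := lt_le_trans M0 (M_le_S x y Gx).
rewrite /triangular_ratio /c_tilde -/(S x y) -/(M x y); split.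
  by rewrite ler_wpM2l ?enorm_ge0 // lef_pV2 ?posrE ?M_le_S.
rewrite mulrCA ler_wpM2l ?enorm_ge0 //.
by rewrite ler_pdivlMr // mulrC ler_pdivrMr // S_le_2M.
Qed.

Let near_boundary_point x (e : R) : G x -> 0 < e ->
  exists2 z, boundary G z & enorm (x - z) < (1 + e) * d x.
Proof.
move=> Gx e0.
have hi : has_inf [set enorm (x - z) | z in boundary G].
  split; last by exists 0 => _ [w _ <-]; exact: enorm_ge0.
  have [z bz] := boundary_neq0 _ _ _ openG x Gx properG.
  by exists (enorm (x - z)), z.
have [_ [z bz <-] zlt] := inf_adherent (mulr_gt0 e0 (d_gt0 x Gx)) hi.
by exists z => //; rewrite mulrDl mul1r.
Qed.

(** Supplies the test point for both sharpness proofs, with [t] the fraction of the segment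
    travelled. The condition [t * (1 + e) <= 1] keeps [y] in the ball of radius [d x]. *)
Let point_on_segment x (t e : R) : G x -> 0 < e -> 0 < t <= 1 ->
    t * (1 + e) <= 1 ->
  exists y, [/\ G y, 0 < enorm (x - y), enorm (x - y) <= t * (1 + e) * d x,
    S x y <= (2 - t) * (1 + e) * d x & M x y <= (1 + e) * d x].
Proof.
move=> Gx e0 /andP[t0 t1] te.
have [z bz zlt] := near_boundary_point x e Gx e0.
have dz := d_le x z bz; have d0 := d_gt0 x Gx.
pose y := x + t *: (z - x).
have xy : enorm (x - y) = t * enorm (x - z).
  by rewrite /y opprD addNKr -scalerN opprB enormZ gtr0_norm.
have yz : enorm (y - z) = (1 - t) * enorm (x - z).
  have -> : y - z = (1 - t) *: (x - z).
    by rewrite /y scalerBl scale1r -(opprB x z) scalerN addrAC.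
  by rewrite enormZ ger0_norm // subr_ge0.
exists y; split.
- apply: (ball_sub_domain _ _ _ openG (d x) x y Gx (d_le x)).
  rewrite xy; nra.
- rewrite xy mulr_gt0 //; lra.
- rewrite xy -mulrA ler_pM2l //; exact: ltW.
(* The sum of distances to [z] is [(2 - t) * enorm (x - z)]. *)
- apply: le_trans (S_le x y z bz) _; rewrite (enormB _ _ z) yz; nra.
- apply: le_trans (M_le x y z bz) _; rewrite ge_max yz (ltW zlt) /=; nra.
Qed.

Lemma lower_constant_sharp x (a : R) : G x ->
  (forall y, G y -> a * triangular_ratio G x y <= c_tilde G x y) -> a <= 1.
Proof.
move=> Gx ha; apply/ler_addgt0Pr => e0 e0_gt0.
(* With [t = 1 / (1 + e)] the bound on [S] has factor [(2 - t) * (1 + e) = 1 + 2 * e], which is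
   [1 + e0]. *)
pose e := e0 / 2; have e_gt0 : 0 < e by rewrite divr_gt0.
pose t := (1 + e)^-1.
have t0 : 0 < t by rewrite invr_gt0; lra.
have te : t * (1 + e) = 1 by rewrite mulVf //; apply/lt0r_neq0; lra.
have t01 : 0 < t <= 1 by rewrite t0 /=; nra.
have te1 : t * (1 + e) <= 1 by rewrite te.
have [y [Gy xy0 _ Sle _]] := point_on_segment x t e Gx e_gt0 t01 te1.
have d0 := d_gt0 x Gx; have Md := M_ge_d x y Gx; have MS := M_le_S x y Gx.
have M0 : 0 < M x y by lra. have S0 : 0 < S x y by lra.
have := ha y Gy; rewrite /triangular_ratio /c_tilde -/(S x y) -/(M x y).
rewrite mulrCA ler_pM2l // ler_pdivrMr // mulrC ler_pdivlMr // => aMS.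
have eE : e0 = 2 * e by rewrite /e; lra.
have Sle' : S x y <= (1 + 2 * e) * d x.
  by apply: le_trans Sle _; rewrite mulrBl te; lra.
(* The chain [a * M <= S <= (1 + 2 * e) * d <= (1 + 2 * e) * M] contradicts [alt]. *)
rewrite eE leNgt; apply/negP => alt; nra.
Qed.

Lemma upper_constant_sharp x (b : R) : G x ->
  (forall y, G y -> c_tilde G x y <= b * triangular_ratio G x y) -> 2 <= b.
Proof.
move=> Gx hb; rewrite leNgt; apply/negP => b2.
(* The test point gives [2 - e <= b * (1 + e)], which fails for this [e]. *)
pose e : R := Num.min 1 ((2 - b) / 4).
have e1 : e <= 1 by rewrite /e ge_min lexx.
have e4 : e <= (2 - b) / 4 by rewrite /e ge_min lexx orbT.
have e_gt0 : 0 < e by rewrite /e lt_min ltr01 /= divr_gt0 // subr_gt0.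
(* Chosen so that [enorm (x - y) <= e * d x]. *)
pose t := e / (1 + e).
have t0 : 0 < t by rewrite divr_gt0 //; lra.
have te : t * (1 + e) = e by rewrite divfK //; apply/lt0r_neq0; lra.
have t01 : 0 < t <= 1 by rewrite t0 /=; nra.
have te1 : t * (1 + e) <= 1 by rewrite te.
have [y [Gy xy0 xyle _ Mle]] := point_on_segment x t e Gx e_gt0 t01 te1.
rewrite te in xyle.
have d0 := d_gt0 x Gx; have Md := M_ge_d x y Gx; have MS := M_le_S x y Gx.
have M0 : 0 < M x y by lra. have S0 : 0 < S x y by lra.
(* By the triangle inequality, each sum in the infimum is at least
   [2 * enorm (x - z) - enorm (x - y)]. *)
have Sge : (2 - e) * d x <= S x y.
  apply: inf_image_ge; first exact: boundary_neq0 Gx _.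
  move=> z bz; have := d_le x z bz; have := ler_enorm_sub _ _ y x z.
  rewrite (enormB _ _ z); lra.
have := hb y Gy; rewrite /triangular_ratio /c_tilde -/(S x y) -/(M x y).
rewrite mulrCA ler_pM2l // ler_pdivlMr // mulrC ler_pdivrMr // => SbM.
(* Positivity of [b] lets the upper bound on [M] be multiplied by [b]. *)
have b0 : 0 < b by rewrite -(pmulr_lgt0 _ M0); lra.
have : (2 - e) * d x <= b * (1 + e) * d x.
  by apply: le_trans Sge _; apply: le_trans SbM _; rewrite -mulrA ler_pM2l.
(* Since [b < 2], [h] yields [2 - b <= e * (1 + b) < 3 * e], against [e <= (2 - b) / 4]. *)
rewrite ler_pM2r // => h; nra.
Qed.

End Comparison.

Theorem lemma3p1 (R : realType) (n : nat) (G : set 'rV[R]_n)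
    (hG : domain G) (hGproper : G `<` [set: 'rV[R]_n]) :
  (forall x y : 'rV[R]_n, G x -> G y ->
     triangular_ratio G x y <= c_tilde G x y /\
     c_tilde G x y <= 2 * triangular_ratio G x y) /\
  (forall x : 'rV[R]_n, G x ->
     is_greatest
       [set a : R | forall y : 'rV[R]_n, G y ->
          a * triangular_ratio G x y <= c_tilde G x y] 1 /\
     is_least
       [set b : R | forall y : 'rV[R]_n, G y ->
          c_tilde G x y <= b * triangular_ratio G x y] 2).
Proof.
case: hG => _ openG _.
have bounds := @triangular_ratio_c_tilde_bounds R n G openG hGproper.
split=> [x y Gx _|x Gx]; first exact: bounds.
split; split=> /=.
- by move=> y _; rewrite mul1r; case: (bounds x y Gx).
- by move=> a; exact: lower_constant_sharp.
- by move=> y _; case: (bounds x y Gx).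
- by move=> b; exact: upper_constant_sharp.
Qed.
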